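(* There is an absolute constant $C$ such that the following holds. Let $N=2^n$. Then, as $n\to\infty$, all but a $o(1)$ fraction of NOF permutation problems $I$ over the alphabet $[N]$ satisfy $\mathrm{cc}(\tilde I, P_{NOF}) \ge \frac{n}{3}-C$.
   Context: A NOF permutation problem over alphabet $\Sigma=[N]$ is a set $I\subset\Sigma^3$ such that for any two coordinates there is exactly one value of the third coordinate giving a triple of $I$ (equivalently, an $N\times N$ Latin square). It is viewed as a three-player promise problem over alphabet $\Gamma=\Sigma\times\Sigma$ with promise $P_{NOF}=\{((i,j),(j,k),(k,i)) : i,j,k\in\Sigma\}$ (the support of the matrix multiplication tensor $\langle N,N,N\rangle=\sum_{i,j,k}x_{i,j}y_{j,k}z_{k,i}$) and accepting set $\tilde I=\{((x,y),(y,z),(z,x)) : (x,y,z)\in I\}$. For a promise problem $I'\subset P\subset\Gamma^3$, three players receive $a,b,c$ respectively with $(a,b,c)\in P$ and must decide whether $(a,b,c)\in I'$; $\mathrm{cc}(I',P)$ is the deterministic communication complexity in the shared-blackboard model: players in cyclic order either append bits (depending on own input and current board), accept, or reject; the input is accepted iff all players accept; a correct protocol accepts all of $I'$ and rejects all of $P\setminus I'$; cost is the maximum number of bits written. *)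

(* Defs.v *)
From mathcomp Require Import all_boot all_order all_algebra.
From mathcomp Require Import all_classical all_reals all_analysis.

Set Implicit Arguments.
Unset Strict Implicit.
Unset Printing Implicit Defensive.

(* Three-player communication with a shared blackboard.  Players are the
   elements of 'I_3, an element x of Gamma^3 is a 3-tuple, and player p sees
   only tnth x p.  The blackboard is a plain bit string: nothing but the bits
   written so far (no separators, no turn counter) is visible. *)

Inductive action := Append of bitseq | Accept | Reject.

(* The messages which a player may write on a given board are self-delimiting
   (no message is a proper prefix of another), so that the division of the
   board into messages carries no information beyond its bits.  The case of one
   bit per turn is included, and so is a turn without message, but only as the
   sole message possible on that board. *)
Record protocol (T : Type) := Protocol {
  act : 'I_3 -> T -> bitseq -> action;
  act_prefix_free : forall (p : 'I_3) (w : bitseq) (a b : T) (s t : bitseq),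
    act p a w = Append s -> act p b w = Append t -> prefix s t -> s = t
}.

(* [final_board pi x p w v]: if it is the turn of player p on board w, then the
   run of pi on x halts, with final board v.  Writing stops as soon as the
   player whose turn it is accepts or rejects; a run that never stops has no
   final board. *)
Inductive final_board (T : Type) (pi : protocol T) (x : 3.-tuple T) :
    'I_3 -> bitseq -> bitseq -> Prop :=
| FinalHalt p w :
    act pi p (tnth x p) w = Accept \/ act pi p (tnth x p) w = Reject ->
    final_board pi x p w w
| FinalAppend p w s v :
    act pi p (tnth x p) w = Append s ->
    final_board pi x (ordS p) (w ++ s) v ->
    final_board pi x p w v.

Definition all_accept (T : Type) (pi : protocol T) (x : 3.-tuple T)
    (w : bitseq) : Prop :=
  forall p : 'I_3, act pi p (tnth x p) w = Accept.

(* On every promised input the run halts with at most c bits on the board, and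
   all three players accept on the final board exactly when the input is in I. *)
Definition solves_with_cost (T : finType) (I P : {set 3.-tuple T})
    (pi : protocol T) (c : nat) : Prop :=
  forall x, x \in P -> exists w : bitseq,
    [/\ final_board pi x ord0 [::] w, size w <= c & all_accept pi x w <-> x \in I].

Definition cc_le (T : finType) (I P : {set 3.-tuple T}) (c : nat) : Prop :=
  exists pi : protocol T, solves_with_cost I P pi c.

(* Every promise problem has a protocol: the players write their inputs on the
   board one after the other. *)
Section Broadcast.
Variables (T : finType) (I : {set 3.-tuple T}).

Let code (a : T) : bitseq := [seq b == a | b <- enum T].

Let size_code a : size (code a) = #|T|.
Proof. by rewrite size_map -cardE. Qed.

Let code_inj : injective code.
Proof.
move=> a b /eq_in_map eab; apply/eqP; rewrite -(eab a) ?mem_enum //; exact: eqxx.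
Qed.

Let board (x : 3.-tuple T) : bitseq :=
  code (tnth x ord0) ++ code (tnth x (inord 1)) ++ code (tnth x (inord 2)).

Let board_inj : injective board.
Proof.
move=> x y /eqP; rewrite /board !eqseq_cat ?size_code //.
case/and3P=> /eqP/code_inj e0 /eqP/code_inj e1 /eqP/code_inj e2.
apply: eq_from_tnth => -[[|[|[|//]]] i3].
- by rewrite (_ : Ordinal i3 = ord0) //; apply: val_inj.
- by rewrite (_ : Ordinal i3 = inord 1) //; apply: val_inj; rewrite /= inordK.
- by rewrite (_ : Ordinal i3 = inord 2) //; apply: val_inj; rewrite /= inordK.
Qed.

Let bact (p : 'I_3) (a : T) (w : bitseq) : action :=
  if size w == p * #|T| then Append (code a)
  else if [exists x in I, w == board x] then Accept else Reject.

Let bact_prefix_free (p : 'I_3) (w : bitseq) (a b : T) (s t : bitseq) :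
  bact p a w = Append s -> bact p b w = Append t -> prefix s t -> s = t.
Proof.
rewrite /bact; case: eqP => _; last by case: ifP.
move=> [<-] [<-]; rewrite prefixE => /eqP <-.
by rewrite size_code -(size_code b) take_size.
Qed.

Lemma cc_le_exists (P : {set 3.-tuple T}) : exists c, `[< cc_le I P c >].
Proof.
exists (3 * #|T|); apply/asboolP.
exists (Protocol bact_prefix_free) => x _; exists (board x).
have T0 : 0 < #|T| by apply/card_gt0P; exists (tnth x ord0).
have sB : size (board x) = 3 * #|T|.
  by rewrite /board !size_cat !size_code !mulSn mul0n addn0.
have actB p : bact p (tnth x p) (board x) =
              if x \in I then Accept else Reject.
  rewrite /bact sB eqn_mul2r (gtn_eqF (ltn_ord p)) orbF eqn0Ngt T0 /=.
  congr (if _ then _ else _); apply/exists_inP/idP => [[y yI /eqP/board_inj->]//|xI].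
  by exists x.
split; last 2 first.
- by rewrite sB.
- split=> [/(_ ord0)|xI p]; rewrite /= actB; by [case: ifP | rewrite xI].
apply: (@FinalAppend _ _ _ _ _ (code (tnth x ord0))); first by rewrite /= /bact.
rewrite (_ : ordS ord0 = inord 1); last by apply: val_inj; rewrite /= inordK.
apply: (@FinalAppend _ _ _ _ _ (code (tnth x (inord 1)))).
  by rewrite /= /bact size_code inordK // mul1n eqxx.
rewrite (_ : ordS (inord 1) = inord 2); last first.
  by apply: val_inj; rewrite /= !inordK.
apply: (@FinalAppend _ _ _ _ _ (code (tnth x (inord 2)))).
  by rewrite /= /bact size_cat !size_code inordK // mulSn mul1n eqxx.
rewrite -catA; apply: FinalHalt; rewrite /= actB.
by case: ifP; [left | right].
Qed.

End Broadcast.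

Definition cc (T : finType) (I P : {set 3.-tuple T}) : nat :=
  ex_minn (cc_le_exists I P).

Definition nof_permutation_problem (S : finType) (I : {set 3.-tuple S}) : bool :=
  [&& [forall x, forall y, #|[set z | [tuple x; y; z] \in I]| == 1],
      [forall y, forall z, #|[set x | [tuple x; y; z] \in I]| == 1]
    & [forall x, forall z, #|[set y | [tuple x; y; z] \in I]| == 1]].

(* (x, y, z) |-> ((x, y), (y, z), (z, x)) *)
Definition nof_input (S : finType) (t : 3.-tuple S) : 3.-tuple (S * S)%type :=
  [tuple (tnth t p, tnth t (ordS p)) | p < 3].

(* The promise P_NOF over the alphabet S * S, and the problem I~. *)
Definition nof_promise (S : finType) : {set 3.-tuple (S * S)%type} :=
  [set nof_input t | t in [set: 3.-tuple S]].

Definition nof_lift (S : finType) (I : {set 3.-tuple S}) :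
    {set 3.-tuple (S * S)%type} :=
  [set nof_input t | t in I].

(* Main.v *)
Require Import Defs.
From mathcomp Require Import all_classical all_reals all_analysis.
From mathcomp Require Import all_boot all_order all_algebra.
From mathcomp Require Import perm zify lra.
Set Implicit Arguments.
Unset Strict Implicit.
Unset Printing Implicit Defensive.

(** A protocol of cost [c] for [nof_lift I] attaches to each triple of [I] its
    final board.  Since each pair of coordinates determines the triple, this
    gives functions chi1(x,y), chi2(y,z), chi3(z,x) into the fewer than
    [2 ^ c.+1] boards.  Conversely, if the three values agree on (x,y,z), the
    three triples of [I] behind them have the same board, and mixing their
    coordinates (the rectangle property) shows (x,y,z) in [I].  So [I] is
    determined by the chi's, and at most [2 ^ (3 * c.+1 * N^2)] problems have
    cost at most [c].

    On the other hand there are at least [2 ^ ((n - 4) * N^2)] Latin squares of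
    order [N = 2 ^ n]: their symbols can be chosen bit by bit, where each bit
    splits every colour class, a [2k]-regular bipartite graph, into two
    [k]-regular ones.  As in Schrijver's bound for Eulerian orientations, there
    are many splittings: pair up the edges at each vertex; the pairings on the
    two sides form even cycles, whose alternating colourings are splittings. *)

(** * Alternating colourings of even cycles *)

(** Each cycle formed by the pairings [a] and [b] splits into two orbits of [p], which [a] and [b]
    both exchange. The colouring tells these orbits apart by comparing the ranks of their roots. *)
Lemma alternating_bipartition (E : finType) (a b : E -> E) :
  involutive a -> involutive b -> (forall e, a e != e) -> (forall e, b e != e) ->
  exists chi : E -> bool,
    (forall e, chi (a e) = ~~ chi e) /\ (forall e, chi (b e) = ~~ chi e).
Proof.
move=> aK bK a_fpf b_fpf; pose p e := b (a e).
have p_inj : injective p by move=> x y /(inv_inj bK)/(inv_inj aK).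
have sym := fconnect_sym p_inj.
(* If [p^(m+2) e = a e], then [p^m (p e) = a (p e)]. So only the exponents 0 and 1 matter, and there
   [a] and [b] have no fixed points. *)
have iter_neq m : forall e, iter m p e != a e /\ iter m.+1 p e != a e.
  elim: m => [|m IH] e /=; first by split; rewrite ?b_fpf // eq_sym a_fpf.
  split; first by have [] := IH e.
  have [+ _] := IH (p e); apply: contraNN => /eqP pe.
  apply/eqP; apply: (inv_inj aK); apply: (inv_inj bK).
  by rewrite aK /p bK -iterSr /= -/(p _) -/(p _) pe.
have a_disc e : froot p e != froot p (a e).
  apply/eqP => /(fingraph.rootP sym)/iter_findex pe.
  by have [] := iter_neq (findex p e (a e)) e; rewrite pe eqxx.
have rootE e : froot p (p e) = froot p e.
  by apply/esym/(fingraph.rootP sym)/fconnect1.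
exists (fun e => enum_rank (froot p e) < enum_rank (froot p (a e))).
have neg e : (enum_rank (froot p (a e)) < enum_rank (froot p e)) =
          ~~ (enum_rank (froot p e) < enum_rank (froot p (a e))).
  have := a_disc e; rewrite -(inj_eq enum_rank_inj) -(inj_eq val_inj) /=.
  by case: ltngtP.
split=> e; first by rewrite aK neg.
have -> : froot p (b e) = froot p (a e) by rewrite -[RHS]rootE /p aK.
have -> : froot p (a (b e)) = froot p e by rewrite -[LHS]rootE /p aK bK.
exact: neg.
Qed.

(** * Labellings of the fibres of a map *)

Lemma card_fibers (E W : finType) (f : E -> W) (d : nat) :
  (forall w, #|[set e | f e == w]| = d) -> #|E| = #|W| * d.
Proof.
move=> fib; rewrite -sum1_card (partition_big f predT) //=.
rewrite -sum_nat_const; apply: eq_bigr => w _.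
by rewrite -(fib w) sum1dep_card.
Qed.

(** Such a [lam] is injective on each fibre of [f]; when the fibres have size [#|L|], it numbers
    each of them bijectively by [L]. *)
Definition labelings (E W L : finType) (f : E -> W) : {set {ffun E -> L}} :=
  [set lam : {ffun E -> L} | injectiveb (fun e => (f e, lam e))].

Section Labelings.
Variables (E W L : finType) (f : E -> W).
Hypothesis fib : forall w, #|[set e | f e == w]| = #|L|.

Lemma labelings_bij lam : lam \in labelings L f -> bijective (fun e => (f e, lam e)).
Proof.
rewrite inE => /injectiveP inj; apply: inj_card_bij => //.
by rewrite card_prod (card_fibers fib).
Qed.

Lemma labelings_neq0 : exists lam, lam \in labelings L f.
Proof.
(* [L] is empty only if [E] is, so the default value for [nth] has to depend on [e]. *)
have /fin_all_exists[l0 _] : forall e : E, exists l : L, l \in L.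
  move=> e; apply/card_gt0P; rewrite -(fib (f e)).
  by apply/card_gt0P; exists e; rewrite inE.
pose F w := enum [set e | f e == w].
exists [ffun e => nth (l0 e) (enum L) (index e (F (f e)))].
rewrite inE; apply/injectiveP => e1 e2 []; rewrite !ffunE => ef; rewrite -ef => eqn.
have idx e : f e = f e1 -> e \in F (f e1) /\ index e (F (f e1)) < size (enum L).
  move=> fe; have eF : e \in F (f e1) by rewrite mem_enum inE fe.
  by rewrite -cardE -(fib (f e1)) cardE index_mem.
have [[i1 lt1] [i2 lt2]] := (idx e1 erefl, idx e2 (esym ef)).
move/eqP: eqn; rewrite (set_nth_default (l0 e1) (l0 e2)) // nth_uniq ?enum_uniq //.
by move=> /eqP eqi; rewrite -(nth_index e1 i1) eqi nth_index.
Qed.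

(** Relative to a fixed labelling [lam0], a labelling amounts to one permutation of [L] for each
    fibre. *)
Lemma card_labelings : #|labelings L f| = (#|L|)`! ^ #|W|.
Proof.
have [lam0 lam0P] := labelings_neq0; have [h fK hK] := labelings_bij lam0P.
have fh w l : f (h (w, l)) = w by have [] := hK (w, l).
have lh w l : lam0 (h (w, l)) = l by have [] := hK (w, l).
pose F (s : {ffun W -> {perm L}}) := [ffun e => s (f e) (lam0 e)].
have F_inj : injective F.
  move=> s t /ffunP eqF; apply/ffunP => w; apply/permP => l.
  by have := eqF (h (w, l)); rewrite !ffunE fh lh.
suff -> : labelings L f = F @: setT.
  rewrite card_imset // cardsT card_ffun; congr (_ ^ _).
  rewrite -[in RHS]cardsT -card_perm -cardsT; apply: eq_card => s.
  by rewrite !inE; apply/esym/subsetP => x; rewrite inE.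
apply/setP => lam; apply/idP/imsetP => [lamP|[s _ ->]].
  have s_inj w : injective (fun l => lam (h (w, l))).
    move=> l1 l2 eql; have [g gK _] := labelings_bij lamP.
    have: h (w, l1) = h (w, l2) by apply: (can_inj gK); rewrite !fh eql.
    by move/(congr1 lam0); rewrite !lh.
  exists [ffun w => perm (@s_inj w)] => //.
  by apply/ffunP => e; rewrite !ffunE permE fK.
rewrite inE; apply/injectiveP => e1 e2 []; rewrite !ffunE => ef.
by rewrite ef => /perm_inj el; apply: (can_inj fK); rewrite ef el.
Qed.

End Labelings.

(** * Balanced two-colourings and pairings of fibres *)

Definition balanced (E V : finType) (k : nat) (f : E -> V) (chi : {ffun E -> bool}) :=
  [forall w : V * bool, #|[set e | (f e, chi e) == w]| == k].

(* A labelling by ['I_k * bool] of fibres of size [2k] is a pairing of each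
   fibre with an order on its [k] pairs and an order within each pair. *)
Section Flip.
Variables (E V : finType) (k : nat) (f : E -> V).
Hypothesis fib : forall v, #|[set e | f e == v]| = k.*2.

(** [s] selects the pairs whose two members are exchanged. *)
Definition flip (s : {ffun V * 'I_k -> bool}) (lam : {ffun E -> 'I_k * bool}) :
    {ffun E -> 'I_k * bool} :=
  [ffun e => ((lam e).1, (lam e).2 (+) s (f e, (lam e).1))].

Lemma flipK s : involutive (flip s).
Proof.
move=> lam; apply/ffunP => e; rewrite !ffunE /= addbK.
by case: (lam e).
Qed.

Lemma flip_labelings s lam :
  lam \in labelings ('I_k * bool)%type f ->
  flip s lam \in labelings ('I_k * bool)%type f.
Proof.
rewrite !inE => /injectiveP inj; apply/injectiveP => e1 e2 [].
rewrite !ffunE /= => ef [e_1]; rewrite ef e_1 => /addIb e_2; apply: inj.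
by rewrite ef [lam e1]surjective_pairing e_1 e_2 -surjective_pairing.
Qed.

Lemma card_label : #|{: 'I_k * bool}| = k.*2.
Proof. by rewrite card_prod card_ord card_bool muln2. Qed.

(** The involution [a] exchanges the two members of each pair. A colouring that separates them is
    obtained by flipping the pairs whose [false] member has colour [true]. *)
Lemma labelings_alternating lam : lam \in labelings ('I_k * bool)%type f ->
  exists a : E -> E, [/\ involutive a, forall e, a e != e &
    forall chi : E -> bool, (forall e, chi (a e) = ~~ chi e) ->
      exists s, forall e, (flip s lam e).2 = chi e].
Proof.
move=> lamP; have fibL v : #|[set e | f e == v]| = #|{: 'I_k * bool}|.
  by rewrite card_label.
have [g fK gK] := labelings_bij fibL lamP.
have fg v i : f (g (v, i)) = v by have [] := gK (v, i).
have lg v i : lam (g (v, i)) = i by have [_] := gK (v, i).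
pose a e := g (f e, ((lam e).1, ~~ (lam e).2)).
exists a; split=> [e|e|chi chiP].
- by rewrite /a fg lg /= negbK -surjective_pairing fK.
- by apply/eqP => /(congr1 lam); rewrite lg => /(congr1 snd) /=; case: (lam e).2.
exists [ffun w => chi (g (w.1, (w.2, false)))] => e; rewrite !ffunE /=.
have := chiP e; have := fK e; rewrite /a.
case: (lam e) => i [] /= ge; last by rewrite ge.
by move=> ->; rewrite negbK.
Qed.

Lemma labelings_balanced lam : lam \in labelings ('I_k * bool)%type f ->
  balanced k f [ffun e => (lam e).2].
Proof.
move=> lamP; have fibL v : #|[set e | f e == v]| = #|{: 'I_k * bool}|.
  by rewrite card_label.
have [g fK gK] := labelings_bij fibL lamP.
apply/forallP => -[v b].
rewrite [X in #|pred_of_set X|](_ : _ = [set g (v, (i, b)) | i : 'I_k]).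
  rewrite card_imset ?card_ord // => i j.
  move=> /(congr1 (fun e => (lam e).1)).
  by have [_ ->] := gK (v, (i, b)); have [_ ->] := gK (v, (j, b)).
apply/setP => e; rewrite inE ffunE; apply/eqP/imsetP => [[<- <-]|[i _ ->]].
  by exists (lam e).1 => //; rewrite -surjective_pairing fK.
by have [-> ->] := gK (v, (i, b)).
Qed.

(** Once the bits are read as a colouring, what remains of a labelling numbers each colour class of
    each fibre by ['I_k]. *)
Lemma labelings_fst lam : lam \in labelings ('I_k * bool)%type f ->
  [ffun e => (lam e).1] \in
    labelings 'I_k (fun e => (f e, [ffun e' => (lam e').2] e)).
Proof.
rewrite !inE => /injectiveP inj; apply/injectiveP => e1 e2 [ef].
rewrite !ffunE => e_2 e_1; apply: inj.
by rewrite ef [lam e1]surjective_pairing e_1 e_2 -surjective_pairing.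
Qed.

End Flip.

(** * Counting the splittings of a regular bipartite graph *)

Lemma card_bigcup_le (I T : finType) (P : {pred I}) (F : I -> {set T}) m :
  (forall i, i \in P -> #|F i| <= m) -> #|\bigcup_(i in P) F i| <= #|P| * m.
Proof.
move=> Fm; rewrite -sum_nat_const.
elim/big_rec2: _ => [|i n U Pi leUn]; first by rewrite cards0.
by rewrite (leq_trans (leq_card_setU _ _)) // leq_add ?Fm.
Qed.

Section Split.
Variables (E V : finType) (k : nat) (l r : E -> V).
Hypothesis fibl : forall v, #|[set e | l e == v]| = k.*2.
Hypothesis fibr : forall v, #|[set e | r e == v]| = k.*2.

Let L := ('I_k * bool)%type.

Let agree : {set {ffun E -> L} * {ffun E -> L}} :=
  [set p | [&& p.1 \in labelings L l, p.2 \in labelings L r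
             & [forall e, (p.1 e).2 == (p.2 e).2]]].

Definition splits : {set {ffun E -> bool}} :=
  [set chi | balanced k l chi && balanced k r chi].

(** An alternating colouring of the cycles gives flips that make any two labellings agree. Flips are
    involutions, so every pair of labellings is the image of an agreeing pair under one of
    [(2 ^ (k * #|V|)) ^ 2] pairs of flips. *)
Let all_le_agree : #|labelings L l| * #|labelings L r| <=
  (2 ^ (k * #|V|)) ^ 2 * #|agree|.
Proof.
rewrite -cardsX.
pose F (q : ({ffun V * 'I_k -> bool} * {ffun V * 'I_k -> bool}) *
            ({ffun E -> L} * {ffun E -> L})) :=
  (flip l q.1.1 q.2.1, flip r q.1.2 q.2.2).
have -> : (2 ^ (k * #|V|)) ^ 2 * #|agree| =
    #|setX [set: {ffun V * 'I_k -> bool} * {ffun V * 'I_k -> bool}] agree|.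
  rewrite cardsX cardsT card_prod !card_ffun card_bool card_prod card_ord.
  by rewrite mulnC (mulnC k) mulnn mulnC.
apply: leq_trans (leq_imset_card F _); apply/subset_leq_card/subsetP.
case=> lam rho; rewrite inE /= => /andP[lamP rhoP].
have [a [aK a_fpf aP]] := labelings_alternating fibl lamP.
have [b [bK b_fpf bP]] := labelings_alternating fibr rhoP.
have [chi [/aP[s sP] /bP[t tP]]] := alternating_bipartition aK bK a_fpf b_fpf.
apply/imsetP; exists ((s, t), (flip l s lam, flip r t rho)); last first.
  by rewrite /F /= !flipK.
rewrite in_setX in_setT /agree in_set /= !flip_labelings //=.
by apply/forallP => e; rewrite sP tP.
Qed.

(** An agreeing pair consists of a splitting and, on each side, a numbering of [2 * #|V|] colour
    classes of size [k]. *)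
Let agree_le : #|agree| <= #|splits| * (k`! ^ (2 * #|V|)) ^ 2.
Proof.
pose G (chi : {ffun E -> bool}) (p : {ffun E -> 'I_k} * {ffun E -> 'I_k}) :
    {ffun E -> L} * {ffun E -> L} :=
  ([ffun e => (p.1 e, chi e)], [ffun e => (p.2 e, chi e)]).
pose D (chi : {ffun E -> bool}) := setX (labelings 'I_k (fun e => (l e, chi e)))
                     (labelings 'I_k (fun e => (r e, chi e))).
apply: (@leq_trans #|\bigcup_(chi in splits) (G chi @: D chi)|).
  apply/subset_leq_card/subsetP => -[lam rho].
  rewrite in_set /= => /and3P[lamP rhoP /forallP eq2].
  have chiE : [ffun e => (lam e).2] = [ffun e => (rho e).2].
    by apply/ffunP => e; rewrite !ffunE (eqP (eq2 e)).
  apply/bigcupP; exists [ffun e => (lam e).2].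
    by rewrite inE {2}chiE !labelings_balanced.
  apply/imsetP; exists ([ffun e => (lam e).1], [ffun e => (rho e).1]).
    by rewrite in_setX {2}chiE !labelings_fst.
  by rewrite /G /= {2}chiE; congr pair; apply/ffunP => e;
    rewrite !ffunE -surjective_pairing.
apply: card_bigcup_le => chi; rewrite inE => /andP[/forallP bl /forallP br].
apply: leq_trans (leq_imset_card _ _) _; rewrite cardsX.
rewrite !card_labelings => [|w|w]; last 2 first.
- by rewrite card_ord (eqP (br w)).
- by rewrite card_ord (eqP (bl w)).
by rewrite card_ord card_prod card_bool (mulnC 2) mulnn.
Qed.

Lemma card_splits_fact :
  ((k.*2)`! ^ #|V|) ^ 2 <=
  (2 ^ (k * #|V|)) ^ 2 * (#|splits| * (k`! ^ (2 * #|V|)) ^ 2).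
Proof.
rewrite (leq_trans _ (leq_mul (leqnn _) agree_le)) //.
apply: leq_trans all_le_agree.
by rewrite !card_labelings ?card_label.
Qed.

End Split.

(** This is the lower bound [4^k / (2k)] for the central binomial coefficient. *)
Lemma fact_double_ge k : 0 < k -> 4 ^ k * k`! ^ 2 <= (k.*2)`! * k.*2.
Proof.
case: k => // k _; elim: k => [//|k IH].
rewrite expnS factS expnMn mulnACA.
apply: leq_trans (leq_mul (leqnn _) IH) _.
rewrite (doubleS k.+1) !factS.
rewrite mulnCA mulnC.
have -> : (k.+1).*2.+2 = 2 * k.+2 by rewrite -muln2; lia.
have -> : (k.+1).*2 = 2 * k.+1 by rewrite -muln2; lia.
set F := _`!; nia.
Qed.

(** The factorial bound says that the central binomial coefficient to the power [2 * #|V|] is at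
    most [2 ^ (2 * (k * #|V|))] times the number of splittings. *)
Lemma card_splits (E V : finType) (k : nat) (l r : E -> V) :
  0 < k ->
  (forall v, #|[set e | l e == v]| = k.*2) ->
  (forall v, #|[set e | r e == v]| = k.*2) ->
  2 ^ (2 * (k * #|V|)) <= #|splits k l r| * k.*2 ^ (2 * #|V|).
Proof.
move=> k_gt0 fibl fibr; have := card_splits_fact fibl fibr.
set s := #|splits _ _ _|; set v := #|V|; set e := 2 * v => s_ge.
have le_e : (4 ^ k * k`! ^ 2) ^ e <= ((k.*2)`! * k.*2) ^ e.
  by case: (e) => // e'; rewrite leq_exp2r // fact_double_ge.
have eA : ((k.*2)`! ^ v) ^ 2 = (k.*2)`! ^ e by rewrite -expnM mulnC.
have e2 : (2 ^ (k * v)) ^ 2 = 2 ^ (2 * (k * v)) by rewrite -expnM mulnC.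
have ef : (k`! ^ e) ^ 2 = (k`! ^ 2) ^ e by rewrite -!expnM mulnC.
have e4 : (4 ^ k) ^ e = 2 ^ (2 * (k * v)) * 2 ^ (2 * (k * v)).
  by rewrite -[4]/(2 ^ 2) -!expnM -expnD /e; congr (_ ^ _); lia.
rewrite eA e2 ef in s_ge; rewrite (expnMn (4 ^ k)) e4 [X in _ <= X]expnMn in le_e.
rewrite -(@leq_pmul2l (2 ^ (2 * (k * v)) * (k`! ^ 2) ^ e)); last first.
  by rewrite muln_gt0 !expn_gt0 fact_gt0.
rewrite mulnAC (leq_trans le_e) // (leq_trans (leq_mul s_ge (leqnn _))) //.
by rewrite !mulnA [_ * s * _]mulnAC.
Qed.

(** * Latin squares, one bit of the symbols at a time *)

(** Each colour occurs [d] times in every row and column, so its cells form a [d]-regular bipartite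
    graph. For [d = 1] and [#|K| = #|S|] these are the Latin squares. *)
Definition colorings (S K : finType) (d : nat) : {set {ffun S * S -> K}} :=
  [set g : {ffun S * S -> K} |
    [forall w : K * S, (#|[set c | (g c, c.1) == w]| == d) &&
                      (#|[set c | (g c, c.2) == w]| == d)]].

(** The graphs of all colours are split together, as one bipartite graph with the cells as edges and
    [K * S] as vertices on each side. *)
Lemma colorings_double (S K : finType) (k : nat) : 0 < k ->
  #|colorings S K k.*2| * 2 ^ (2 * (k * (#|K| * #|S|))) <=
  #|colorings S (K * bool)%type k| * k.*2 ^ (2 * (#|K| * #|S|)).
Proof.
move=> k_gt0.
pose lft (g : {ffun S * S -> K}) (c : S * S) := (g c, c.1).
pose rgt (g : {ffun S * S -> K}) (c : S * S) := (g c, c.2).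
pose pairing (p : {ffun S * S -> K} * {ffun S * S -> bool}) :=
  [ffun c => (p.1 c, p.2 c)].
have pairing_inj : injective pairing.
  move=> [g1 c1] [g2 c2] /ffunP eqp; congr pair; apply/ffunP => c;
  by have := eqp c; rewrite !ffunE => -[].
pose D := [set p | (p.1 \in colorings S K k.*2) &&
                   (p.2 \in splits k (lft p.1) (rgt p.1))].
have sub : pairing @: D \subset colorings S (K * bool)%type k.
  apply/subsetP => _ /imsetP[[g chi] + ->].
  rewrite !inE => /andP[_ /andP[/forallP bl /forallP br]].
  apply/forallP => -[[a b] x]; rewrite -{1}(eqP (bl (a, x, b))) -(eqP (br (a, x, b))).
  apply/andP; split; apply/eqP/eq_card => c; rewrite !inE ffunE /=;
    by rewrite !xpair_eqE andbAC.
have := subset_leq_card sub; rewrite card_imset // => leD.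
apply: leq_trans (leq_mul leD (leqnn _)).
have -> : #|D| = \sum_(g in colorings S K k.*2) #|splits k (lft g) (rgt g)|.
  rewrite -sum1_card (partition_big fst (mem (colorings S K k.*2))) => [|p]; last first.
    by rewrite inE => /andP[].
  apply: eq_bigr => g gP; rewrite -sum1_card.
  rewrite (reindex_onto (fun chi => (g, chi)) snd) /=.
    have {}gP : g \in colorings S K k.*2 := gP.
    by apply: eq_bigl => chi; rewrite /D in_set /= gP eqxx !eqxx !andbT.
  by case=> g' chi /andP[_ /eqP /= <-].
rewrite big_distrl /= -[leqLHS]sum_nat_const; apply: leq_sum => g.
rewrite inE => /forallP gP; rewrite -card_prod; apply: card_splits => // w.
  by have /andP[/eqP] := gP w.
by have /andP[_ /eqP] := gP w.
Qed.

(** Bit [i] gains [#|S| * #|S|] in the exponent and loses [#|S| * 2 ^ i.+1 * (n - i)]. The total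
    loss is kept in a closed form that this recursion preserves with equality. *)
Lemma colorings_halving (S : finType) (n i : nat) : #|S| = 2 ^ n -> i <= n ->
  exists2 K : finType, #|K| = 2 ^ i &
    2 ^ (i * (#|S| * #|S|)) <=
    #|colorings S K (2 ^ (n - i))| * 2 ^ (#|S| * (2 ^ i.+1 * (n - i).+2)).
Proof.
move=> cardS; elim: i => [_|i IH lt_in].
  exists unit; rewrite ?card_unit //.
  rewrite mul0n muln_gt0 expn_gt0 andbT subn0 -cardS; apply/card_gt0P.
  exists [ffun => tt]; rewrite inE; apply/forallP => -[[] x].
  apply/andP; split; apply/eqP.
    rewrite -[RHS]cardsT -[RHS](card_imset _ (fun y z => @congr1 _ _ snd (x, y) (x, z))).
    apply: eq_card => -[a b]; rewrite !inE ffunE xpair_eqE /=.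
    by apply/eqP/imsetP => [->|[y _ [->]]] //; exists b.
  rewrite -[RHS]cardsT -[RHS](card_imset _ (fun y z => @congr1 _ _ fst (y, x) (z, x))).
  apply: eq_card => -[a b]; rewrite !inE ffunE xpair_eqE /=.
  by apply/eqP/imsetP => [->|[y _ [_ ->]]] //; exists a.
have [K cardK le_i] := IH (ltnW lt_in); exists (K * bool)%type.
  by rewrite card_prod cardK card_bool expnSr.
have [m def_m] : exists m, n - i = m.+1 by exists (n - i.+1); rewrite subnSK.
have -> : n - i.+1 = m by rewrite subnS def_m.
rewrite def_m in le_i.
have := @colorings_double S K (2 ^ m); rewrite expn_gt0 => /(_ isT).
have -> : (2 ^ m).*2 = 2 ^ m.+1 by rewrite expnS mul2n.
have -> : 2 * (2 ^ m * (#|K| * #|S|)) = #|S| * #|S|.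
  by rewrite cardK cardS !mulnA -expnS -expnD; congr (_ ^ _ * _); lia.
rewrite -expnM cardK => le_d.
rewrite mulSn addnC expnD.
apply: leq_trans (leq_mul le_i (leqnn _)) _.
rewrite mulnAC; apply: leq_trans (leq_mul le_d (leqnn _)) _.
rewrite -mulnA leq_mul2l -expnD leq_exp2l // !expnS; apply/orP; right.
by set N := #|S|; set p := 2 ^ i; lia.
Qed.

(** * Runs of a protocol and the rectangle property *)

Lemma prefix_comparable (T : eqType) (s t w : seq T) :
  prefix s w -> prefix t w -> prefix s t \/ prefix t s.
Proof.
rewrite !prefixE => /eqP sw /eqP tw.
case: (leqP (size s) (size t)) => [le_st|/ltnW le_ts]; [left | right].
  by rewrite -tw take_takel // sw.
by rewrite -sw take_takel // tw.
Qed.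

Section Runs.
Variables (T : Type) (pi : protocol T).

Lemma final_board_prefix x p u w : final_board pi x p u w -> prefix u w.
Proof.
elim=> [q v _|q v s v' _ _]; first exact: prefix_refl.
by apply: prefix_trans; apply: prefix_prefix.
Qed.

Lemma final_board_inj x p u w w' :
  final_board pi x p u w -> final_board pi x p u w' -> w = w'.
Proof.
move=> run; elim: run w' => [q v halt|q v s v' app _ IH] w' run'.
  by case: _ _ _ / run' halt => [//|q' v1 s v2 -> _ []].
case: _ _ _ / run' app IH => [q' v1 halt app|q' v1 t v2 -> run' [<-] IH]; last exact: IH.
by case: halt; rewrite app.
Qed.

Lemma final_board_step x p u w : final_board pi x p u w ->
  u = w \/ exists2 s, act pi p (tnth x p) u = Append s &
                      final_board pi x (ordS p) (u ++ s) w.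
Proof. by case=> [q v _|q v s v' ? ?]; [left | right; exists s]. Qed.

(* A turn without message leaves the board unchanged, so runs could halt on the
   same board at different turns; acceptance by all players at [w] excludes
   this. *)
Lemma final_board_mix (xs : 'I_3 -> 3.-tuple T) (y : 3.-tuple T) p u w :
  (forall q, tnth y q = tnth (xs q) q) ->
  (forall q, act pi q (tnth (xs q) q) w = Accept) ->
  (forall q, final_board pi (xs q) p u w) -> final_board pi y p u w.
Proof.
move=> yE accw runs; have run0 := runs ord0.
elim: run0 runs accw => {p u w} [p u _ _ accu|p u s w app0 _ IH runs accw].
  by apply: FinalHalt; left; rewrite yE.
have [uw|/eqP uw] := eqVneq u w; first by rewrite uw; apply: FinalHalt; left; rewrite yE.
(* All runs continue with the same message: any two candidates extend [u] to prefixes of [w], so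
   they are comparable, and messages are prefix-free. *)
have step q : act pi p (tnth (xs q) p) u = Append s /\
    final_board pi (xs q) (ordS p) (u ++ s) w.
  have [//|[t appq runq]] := final_board_step (runs q).
  suff -> : s = t by [].
  have [run0|[s0 app0' run0]] := final_board_step (runs ord0); first by [].
  move: app0' run0; rewrite app0 => -[<-] run0.
  have sub : prefix s t \/ prefix t s.
    have := prefix_comparable (final_board_prefix run0) (final_board_prefix runq).
    by rewrite !prefix_catr // eqxx.
  case: sub => [|ts]; first exact: (act_prefix_free app0 appq).
  exact/esym/(act_prefix_free appq app0).
apply: (@FinalAppend _ _ _ _ _ s); first by rewrite yE; have [] := step p.
by apply: IH => // q; have [] := step q.
Qed.

End Runs.

(** The mixed input [y] reaches the common board [w], where each player sees a coordinate on which
    it accepts. *)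
Lemma solves_mix (T : finType) (I P : {set 3.-tuple T}) pi c
    (xs : 'I_3 -> 3.-tuple T) (y : 3.-tuple T) w :
  solves_with_cost I P pi c ->
  (forall q, tnth y q = tnth (xs q) q) -> y \in P ->
  (forall q, xs q \in P /\ xs q \in I) ->
  (forall q, final_board pi (xs q) ord0 [::] w) -> y \in I.
Proof.
move=> sol yE yP xsPI runs.
have acc q r : act pi r (tnth (xs q) r) w = Accept.
  have [xP xI] := xsPI q; have [v [run_v _ [_ /(_ xI)]]] := sol _ xP.
  by rewrite (final_board_inj run_v (runs q)).
have run_y := final_board_mix yE (fun q => acc q q) runs.
have [v [run_v _ [+ _]]] := sol _ yP; apply.
by rewrite (final_board_inj run_v run_y) => q; rewrite yE.
Qed.

(** * Counting the cheap permutation problems *)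

Section Code.
Variable c : nat.

(* The first [true] marks where the board begins. *)
Definition pad (w : bitseq) : c.+1.-tuple bool :=
  insubd [tuple of nseq c.+1 false] (nseq (c - size w) false ++ true :: w).

Lemma pad_inj (v w : bitseq) : size v <= c -> size w <= c -> pad v = pad w -> v = w.
Proof.
have idx k (s : bitseq) : index true (nseq k false ++ true :: s) = k.
  by elim: k => //= k ->.
have padK u : size u <= c -> drop (index true (pad u)).+1 (pad u) = u.
  move=> le_uc; rewrite /pad val_insubd size_cat size_nseq /= addnS subnK // eqxx.
  by rewrite idx -addn1 drop_cat size_nseq addn1 ltnNge leqnSn subSnn /= drop0.
by move=> /padK {2}<- /padK {2}<- ->.
Qed.

End Code.

Section Latin.
Variable S : finType.

Let i0 : 'I_3 := ord0.
Let i1 : 'I_3 := @Ordinal 3 1 isT.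
Let i2 : 'I_3 := @Ordinal 3 2 isT.

Let ord3 (p : 'I_3) : [\/ p = i0, p = i1 | p = i2].
Proof. by case: p => -[|[|[|//]]] ?; constructor; apply: val_inj. Qed.

Let tuple3_eta (t : 3.-tuple S) : t = [tuple tnth t i0; tnth t i1; tnth t i2].
Proof. by apply: eq_from_tnth => p; case: (ord3 p) => ->. Qed.

(** The pair at [p] and [ordS p] is what player [p] sees; this puts the three clauses of the
    definition into one cyclic form. *)
Lemma permutation_problem_unique (I : {set 3.-tuple S}) (p : 'I_3) (a b : S) :
  nof_permutation_problem I -> exists t, forall t',
    (t' \in I) && ((tnth t' p, tnth t' (ordS p)) == (a, b)) = (t' == t).
Proof.
have S0 : ordS i0 = i1 by apply: val_inj.
have S1 : ordS i1 = i2 by apply: val_inj.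
have S2 : ordS i2 = i0 by apply: val_inj.
case/and3P => /forallP/(_ a)/forallP/(_ b)/cards1P[z /setP zP]
  /forallP/(_ a)/forallP/(_ b)/cards1P[x /setP xP]
  /forallP/(_ b)/forallP/(_ a)/cards1P[y /setP yP].
case: (ord3 p) => ->; rewrite ?S0 ?S1 ?S2;
  [exists [tuple a; b; z] | exists [tuple x; a; b] | exists [tuple b; y; a]] => t;
  rewrite [t]tuple3_eta; move: (tnth t i0) (tnth t i1) (tnth t i2) => u v w;
  rewrite !(tnth_nth u) /= !xpair_eqE -val_eqE /= !eqseq_cons andbT.
- have := zP w; rewrite !inE.
  by case: (u =P a) => [->|_]; case: (v =P b) => [->|_]; rewrite /= ?andbF ?andbT.
- have := xP u; rewrite !inE.
  by case: (v =P a) => [->|_]; case: (w =P b) => [->|_]; rewrite /= ?andbF ?andbT.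
- have := yP v; rewrite !inE.
  by case: (w =P a) => [->|_]; case: (u =P b) => [->|_]; rewrite /= ?andbF ?andbT.
Qed.

Lemma nof_input_inj : injective (@nof_input S).
Proof.
move=> s t eqst; apply: eq_from_tnth => p.
by have := congr1 (fun x => (tnth x p).1) eqst; rewrite !tnth_mktuple.
Qed.

Lemma card_cheap_permutation_problems (c : nat) :
  #|[set I : {set 3.-tuple S} | nof_permutation_problem I &&
       (cc (nof_lift I) (nof_promise S) <= c)]| <= 2 ^ (c.+1 * (3 * (#|S| * #|S|))).
Proof.
(* The functions [G (p, _)] are the three chi's, and [decode] keeps the triples on which they
   agree. *)
pose decode (G : {ffun 'I_3 * (S * S) -> c.+1.-tuple bool}) : {set 3.-tuple S} :=
  [set t | [forall p, forall q, G (p, (tnth t p, tnth t (ordS p))) ==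
                                G (q, (tnth t q, tnth t (ordS q)))]].
have -> : 2 ^ (c.+1 * (3 * (#|S| * #|S|))) =
    #|[set: {ffun 'I_3 * (S * S) -> c.+1.-tuple bool}]|.
  by rewrite cardsT card_ffun card_tuple card_bool !card_prod card_ord expnM.
apply: leq_trans (leq_imset_card decode _); apply/subset_leq_card/subsetP => I.
rewrite inE => /andP[latI]; rewrite /cc; case: ex_minnP => c' /asboolP[pi sol] _ le_c.
have inP t : nof_input t \in nof_promise S by apply: imset_f.
have [w wP] := fin_all_exists (fun t => sol _ (inP t)).
have [T TP] := fin_all_exists (fun q : 'I_3 * (S * S) =>
  permutation_problem_unique q.1 q.2.1 q.2.2 latI).
apply/imsetP; exists [ffun q => pad c (w (T q))] => //.
have TI q : T q \in I by have := TP q (T q); rewrite eqxx => /andP[].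
apply/setP => t; rewrite inE; apply/idP/forallP => [tI p|eqG].
  have Tt q : T (q, (tnth t q, tnth t (ordS q))) = t.
    by apply/esym/eqP; rewrite -TP tI eqxx.
  by apply/forallP => q; rewrite !ffunE !Tt.
(* Player [p] cannot tell [t] from the triple [T (Q p)] of [I]. Agreement of the codes gives these
   three triples the same final board. *)
pose Q p := (p, (tnth t p, tnth t (ordS p))).
pose xs p := nof_input (T (Q p)).
have size_w q : size (w (T q)) <= c.
  by have [_ le_w _] := wP (T q); apply: leq_trans le_w le_c.
suff /imsetP[t' t'I /nof_input_inj ->] : nof_input t \in nof_lift I by [].
apply: (@solves_mix _ _ _ _ _ xs _ (w (T (Q ord0))) sol) => // [p|p|p].
- rewrite !tnth_mktuple; have := TP (Q p) (T (Q p)); rewrite eqxx => /andP[_ /eqP].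
  by [].
- by split; [apply: inP | apply: imset_f].
have -> : w (T (Q ord0)) = w (T (Q p)).
  apply: (@pad_inj c) => //.
  by have /forallP/(_ p)/eqP := eqG ord0; rewrite !ffunE.
by have [] := wP (T (Q p)).
Qed.

(** * Lower bound on the number of permutation problems *)

Lemma card_colorings_le (K : finType) : #|K| = #|S| ->
  #|colorings S K 1| <= #|[set I : {set 3.-tuple S} | nof_permutation_problem I]|.
Proof.
move=> cardK.
have [phi [psi phiK psiK]] : exists phi : S -> K, bijective phi.
  exists (fun z => enum_val (cast_ord (esym cardK) (enum_rank z))).
  by apply: inj_card_bij; rewrite ?cardK // => x y /enum_val_inj/cast_ord_inj/enum_rank_inj.
pose graph (g : {ffun S * S -> K}) :=
  [set t : 3.-tuple S | g (tnth t i0, tnth t i1) == phi (tnth t i2)].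
have graph_inj : injective graph.
  move=> g h eqgh; apply/ffunP => -[x y].
  have := congr1 (fun I : {set 3.-tuple S} => [tuple x; y; psi (g (x, y))] \in I) eqgh.
  by rewrite !inE !(tnth_nth x) /= psiK eqxx => /esym/eqP ->.
rewrite -(card_imset _ graph_inj); apply/subset_leq_card/subsetP => _ /imsetP[g gP ->].
(* Colourings count cells, permutation problems count single coordinates; on one row or column,
   parametrised by [F], the counts coincide. *)
have fib1 (A : {set S * S}) (F : S -> S * S) :
  injective F -> A \subset codom F -> #|[set y | F y \in A]| = #|A|.
  move=> Finj sub; rewrite -(card_imset _ Finj); apply: eq_card => q.
  apply/imsetP/idP => [[y + ->]|qA]; first by rewrite inE.
  by have /codomP[y qy] := subsetP sub _ qA; exists y; rewrite // inE -qy.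
move: gP; rewrite !inE => /forallP gP.
apply/and3P; split; apply/forallP => a; apply/forallP => b.
- apply/cards1P; exists (psi (g (a, b))); apply/setP => z.
  by rewrite !inE !(tnth_nth a) /= -(inj_eq (can_inj psiK)) ?phiK.
- have /andP[_ /eqP g1] := gP (phi b, a).
  apply/eqP/(etrans _ g1).
  rewrite -[RHS](fib1 _ (fun x => (x, a))) => [|x y []//|]; last first.
    by apply/subsetP => -[x y]; rewrite inE => /eqP[_ ->]; apply/codomP; exists x.
  by apply: eq_card => x; rewrite !inE !(tnth_nth a) /= xpair_eqE eqxx andbT.
- have /andP[/eqP g1 _] := gP (phi b, a).
  apply/eqP/(etrans _ g1).
  rewrite -[RHS](fib1 _ (fun y => (a, y))) => [|x y []//|]; last first.
    by apply/subsetP => -[x y]; rewrite inE => /eqP[_ ->]; apply/codomP; exists y.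
  by apply: eq_card => x; rewrite !inE !(tnth_nth a) /= xpair_eqE eqxx andbT.
Qed.

(** After all [n] bits the loss is [#|S| * (2 ^ n.+1 * 2)], which is [4 * (#|S| * #|S|)]. *)
Lemma card_permutation_problems_ge (n : nat) : #|S| = 2 ^ n ->
  2 ^ (n * (#|S| * #|S|)) <=
  #|[set I : {set 3.-tuple S} | nof_permutation_problem I]| * 2 ^ (4 * (#|S| * #|S|)).
Proof.
move=> cardS; have [K cardK] := colorings_halving cardS (leqnn n).
rewrite subnn expn0 => le_n; apply: leq_trans le_n _.
have le_K := @card_colorings_le K (etrans cardK (esym cardS)).
rewrite leq_mul // leq_exp2l // expnS -cardS; lia.
Qed.

End Latin.

(** * Comparison of the two counts *)

Lemma card_cheap_small (n : nat) (B : {set {set 3.-tuple 'I_(2 ^ n)}}) :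
  {subset B <= [pred I | nof_permutation_problem I &&
     (3 * cc (nof_lift I) (nof_promise 'I_(2 ^ n)) + 12 < n)]} ->
  #|B| * 2 ^ n <=
  #|[set I : {set 3.-tuple 'I_(2 ^ n)} | nof_permutation_problem I]|.
Proof.
move=> subB; have [n_small|n_big] := ltnP n 13.
  rewrite (_ : #|B| = 0) //; apply: eq_card0 => I; apply/negbTE/negP => /subB.
  by rewrite inE => /andP[_]; lia.
(* This is the largest cost with [3 * c + 12 < n]. *)
pose c := (n - 13) %/ 3.
have := @card_permutation_problems_ge 'I_(2 ^ n) n (card_ord _).
have := @card_cheap_permutation_problems 'I_(2 ^ n) c.
rewrite !card_ord; set M := 2 ^ n * 2 ^ n => le_c ge_n.
have le_B : #|B| <= 2 ^ (c.+1 * (3 * M)).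
  apply: leq_trans le_c; apply/subset_leq_card/subsetP => I /subB.
  by rewrite !inE => /andP[-> /=]; rewrite /c; lia.
rewrite -(@leq_pmul2r (2 ^ (4 * M))) ?expn_gt0 //; apply: leq_trans ge_n.
apply: leq_trans (leq_mul (leq_mul le_B (leqnn _)) (leqnn _)) _.
rewrite -!expnD leq_exp2l //.
(* The exponent on the left is at most [(n - 10) * M + n + 4 * M], and [n <= M] makes this at most
   [n * M]. *)
have le_nM : n <= M by rewrite /M; have := ltn_expl n (isT : 1 < 2); nia.
have : c.+1 * 3 <= n - 10 by rewrite /c; lia.
by nia.
Qed.

Import Order.TTheory GRing.Theory Num.Theory.
Import numFieldNormedType.Exports.
Local Open Scope classical_set_scope.
Local Open Scope ring_scope.

Theorem mainTheorem4 (R : realType) :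
  exists C : R,
    (fun n : nat =>
       #|[set I : {set 3.-tuple 'I_(2 ^ n)} |
            nof_permutation_problem I &&
            ~~ (n%:R / 3 - C <= (cc (nof_lift I) (nof_promise 'I_(2 ^ n)))%:R)]%SET|%:R
       / #|[set I : {set 3.-tuple 'I_(2 ^ n)} | nof_permutation_problem I]%SET|%:R : R)
    @ \oo --> (0 : R).
Proof.
(* A cost below [n / 3 - 4] means [3 * cc + 12 < n]; the fraction of such problems is at most
   [2^-n]. *)
exists 4.
have half_cvg : (fun n : nat => (2^-1 : R) ^+ n) @ \oo --> (0 : R).
  by apply: cvg_expr; rewrite ger0_norm ?invr_ge0 // invf_lt1 // ltr1n.
apply: (squeeze_cvgr _ (cvg_cst 0) half_cvg); apply: nearW => n.
set B := [set I | _ && ~~ _]%SET; set A := [set I | _]%SET.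
rewrite divr_ge0 //=.
have A_gt0 : (0 < #|A|)%N.
  have := @card_permutation_problems_ge 'I_(2 ^ n) n (card_ord _).
  by rewrite -/A; case: #|A| => //; rewrite mul0n leqn0 expn_eq0.
rewrite ler_pdivrMr ?ltr0n // mulrC exprVn ler_pdivlMr ?exprn_gt0 //.
rewrite -natrX -natrM ler_nat; apply: card_cheap_small => I.
rewrite !inE -ltNge => /andP[-> /=].
rewrite ltrBrDr ltr_pdivlMr // => lt_n.
rewrite -(ltr_nat R) natrD natrM; lra.
Qed.
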